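(* For all positive integers $N$ and all integers $m$ with $0\le m\le N^2/4$, $\mathrm{cr}_3(N,m)\in O\bigl((m^2/N)\log(m/N)\bigr)$, with an absolute implied constant. That is, there is an absolute constant $C$ such that for all such $N$ and $m$ there is a (proper) 3-dimensional geometric grid graph with exactly $m$ edges, volume at most $N$, and at most $C\,\bigl|(m^2/N)\log(m/N)\bigr|$ crossings.
   Context: Let $\mathbb{N}=\{1,2,3,\dots\}$. For positive integers $X_1,\dots,X_d$, the $X_1\times\cdots\times X_d$ grid is the set $\{(x_1,\dots,x_d): x_i\in\{1,\dots,X_i\}\text{ for all }i\}\subset\mathbb{N}^d$; its volume is $\prod_{i=1}^d X_i$. A $d$-dimensional geometric grid graph $G$ is a finite simple graph whose vertex set is a subset of $\mathbb{N}^d$; each edge $uw$ is identified with the open straight line segment with endpoints $u$ and $w$. All geometric grid graphs are assumed to be proper: for every edge $uw\in E(G)$ and every vertex $x\in V(G)$, the point $x$ does not lie on the open segment $uw$. The volume $\mathrm{vol}(G)$ is the volume of the minimal $X_1\times\cdots\times X_d$ grid containing $V(G)$. Two distinct edges of $G$ cross (form a crossing) if, as open segments, they have a point in common; $\mathrm{cr}(G)$ is the number of crossings, i.e. of unordered pairs of distinct edges that cross. Define $\mathrm{cr}_d(N,m)=\min\{\mathrm{cr}(G): G\text{ is a }d\text{-dimensional (proper) geometric grid graph, } |E(G)|=m,\ \mathrm{vol}(G)\le N\}$. Convention: $f\in O(g)$ means $|f|\le C|g|$ for a constant $C$, and $(m^2/N)\log(m/N)$ is read as $0$ when $m=0$.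 *)

(* Defs.v *)
From HB Require Import structures.
From mathcomp Require Import all_boot all_order all_algebra finmap.
From mathcomp Require Import boolp classical_sets reals exp.

Set Implicit Arguments.
Unset Strict Implicit.
Unset Printing Implicit Defensive.

Import Order.TTheory GRing.Theory Num.Theory.

Local Open Scope fset_scope.
Local Open Scope ring_scope.

Definition real_point (R : realType) (d : nat) (x : 'rV[nat]_d) : 'rV[R]_d :=
  map_mx (fun k : nat => k%:R) x.
Arguments real_point R {d} x.

Definition open_segment (R : realType) (d : nat) (a b : 'rV[R]_d) :
    set 'rV[R]_d :=
  [set p | exists t : R, (0 < t < 1) /\ p = (1 - t) *: a + t *: b]%classic.

(* An edge is the two-element set of its endpoints; the segment does not depend
   on the order in which they are listed. *)
Definition edge_segment (R : realType) (d : nat) (e : {fset 'rV[nat]_d}) :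
    set 'rV[R]_d :=
  [set p | exists u w : 'rV[nat]_d, e = [fset u; w] /\
     open_segment (real_point R u) (real_point R w) p]%classic.
Arguments edge_segment R {d} e.

(* Coordinates are positive because grids live in {1, 2, ...}^d. *)
Record grid_graph (R : realType) (d : nat) := GridGraph {
  vertices : {fset 'rV[nat]_d};
  edges : {fset {fset 'rV[nat]_d}};
  vertices_gt0 : forall x, x \in vertices -> forall i, (0 < x ord0 i)%N;
  edges_simple : forall e, e \in edges -> e `<=` vertices /\ #|` e| = 2%N;
  edges_proper : forall e x, e \in edges -> x \in vertices ->
    ~ edge_segment R e (real_point R x)
}.

Definition in_grid (d : nat) (X : 'I_d -> nat) (x : 'rV[nat]_d) : Prop :=
  forall i, (1 <= x ord0 i <= X i)%N.

(* Grid sides are positive, so the side is 1 when there are no vertices. *)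
Definition grid_side (R : realType) (d : nat) (G : grid_graph R d) (i : 'I_d) :
    nat :=
  maxn 1 (\max_(x <- vertices G) x ord0 i).

Definition vol (R : realType) (d : nat) (G : grid_graph R d) : nat :=
  (\prod_(i < d) grid_side G i)%N.

Lemma grid_side_gt0 (R : realType) (d : nat) (G : grid_graph R d) (i : 'I_d) :
  (0 < grid_side G i)%N.
Proof. by rewrite /grid_side leq_maxl. Qed.

Lemma in_grid_side (R : realType) (d : nat) (G : grid_graph R d) x :
  x \in vertices G -> in_grid (grid_side G) x.
Proof.
move=> xG i; rewrite (vertices_gt0 xG) /= /grid_side leq_max.
by apply/orP; right; apply: (leq_bigmax_seq x).
Qed.

Lemma grid_side_min (R : realType) (d : nat) (G : grid_graph R d)
    (X : 'I_d -> nat) :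
  (forall i, (0 < X i)%N) -> (forall x, x \in vertices G -> in_grid X x) ->
  forall i, (grid_side G i <= X i)%N.
Proof.
move=> X0 XG i; rewrite /grid_side geq_max X0 /=.
by apply/bigmax_leqP_seq => x xG _; have /andP[] := XG x xG i.
Qed.

Definition edges_cross (R : realType) (d : nat) (e f : {fset 'rV[nat]_d}) :
    Prop :=
  (edge_segment R e `&` edge_segment R f !=set0)%classic.
Arguments edges_cross R {d} e f.

Definition is_crossing (R : realType) (d : nat)
    (c : {fset {fset 'rV[nat]_d}}) : Prop :=
  exists e f, [/\ e != f, c = [fset e; f] & edges_cross R e f].
Arguments is_crossing R {d} c.

Definition crossings (R : realType) (d : nat) (G : grid_graph R d) :
    {fset {fset {fset 'rV[nat]_d}}} :=
  [fset c in fpowerset (edges G) | `[< is_crossing R c >]].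

Definition cr (R : realType) (d : nat) (G : grid_graph R d) : nat :=
  #|` crossings G|.

Definition cr_admissible (R : realType) (d N m : nat) (G : grid_graph R d) :
    Prop :=
  #|` edges G| = m /\ (vol G <= N)%N.

(* [is_cr_min R d N m k] says that the minimum cr_d(N, m) exists and equals k;
   it is a relation because there may be no admissible graph. *)
Definition is_cr_min (R : realType) (d N m k : nat) : Prop :=
  (exists G : grid_graph R d, cr_admissible N m G /\ cr G = k) /\
  (forall G : grid_graph R d, cr_admissible N m G -> (k <= cr G)%N).

(* Main.v *)
Require Import Defs.
From HB Require Import structures.
From mathcomp Require Import all_boot all_order all_algebra finmap.
From mathcomp Require Import boolp classical_sets reals exp.
From mathcomp Require Import zify ring lra.

Set Implicit Arguments.
Unset Strict Implicit.
Unset Printing Implicit Defensive.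

Import Order.TTheory GRing.Theory Num.Theory.

Local Open Scope fset_scope.
Local Open Scope ring_scope.

(** Call a pair of lattice points visible when the gcd of its coordinate
    differences is 1: these are the pairs that span an edge avoiding all other
    lattice points, so any set of visible pairs of a box gives a proper graph.

    For m well above N the graph lives in the cube of side n, the integer part
    of the cube root of N, and uses m of the visible pairs at sup-distance at
    most L, for the least L that provides m of them.  A union bound over the
    possible divisors d >= 2 of the coordinate differences shows that every
    point of the cube sees at least about 3/4 of the points of a subcube of
    side L around it ([count_visible]).  Hence n^3 L^3 = O(m), and L = n
    suffices for m <= N^2/4 because 3/4 exceeds 1/2.

    If the edges u, u + a and v, v + b cross, then a, b and c = v - u are
    linearly dependent.  If a and b are parallel, the two edges coincide
    ([crossing_parallel_eq]).  Otherwise a, b, c lie in a common plane with a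
    primitive normal w of norm at most O(L^2).  Such a plane meets the box of
    radius M = 2L in only O(M^2/|w|) points, provided that it contains two
    independent ones ([size_plane_le]); summing the cube of this bound over all
    w gives O(L^6 log L) triples ([size_coplanar_le_ln]), where the logarithm is
    the harmonic sum that results from O(r^2) normals of norm r contributing
    O(L^6/r^3) each.  Multiplying by the n^3 positions of u, the number of
    crossings is O(N (m/N)^2 log(m/N)).

    The logarithm vanishes at m = N, so crossing-free graphs are needed nearby:
    a triangulated 2 x k ladder has 4k - 3 edges ([exists_planar_graph]) and
    covers all m up to 2N - 5.  For bounded N any graph will do whenever the
    logarithm is nonzero, and all visible pairs of a 2 x k box suffice for
    m <= N^2/4 when N >= 4 ([exists_graph]). *)

(** * Boxes of triples *)

Definition prod3 (T : Type) (r s t : seq T) : seq (T * T * T) :=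
  [seq (p, z) | p <- [seq (x, y) | x <- r, y <- s], z <- t].

Lemma size_prod3 (T : Type) (r s t : seq T) :
  size (prod3 r s t) = (size r * size s * size t)%N.
Proof. by rewrite /prod3 !size_allpairs. Qed.

Lemma mem_prod3 (T : eqType) (r s t : seq T) x y z :
  ((x, y, z) \in prod3 r s t) = [&& x \in r, y \in s & z \in t].
Proof.
apply/allpairsP/and3P => [[[[a b] c] /= [/allpairsP[[d e] /= [? ? [-> ->]]]]]|[? ? ?]].
  by move=> ? [-> -> ->].
exists ((x, y), z); split=> //=; exact: allpairs_f.
Qed.

Lemma uniq_prod3 (T : eqType) (r s t : seq T) :
  uniq r -> uniq s -> uniq t -> uniq (prod3 r s t).
Proof.
by move=> *; rewrite !allpairs_uniq // => -[? ?] [? ?] _ _ [-> ->].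
Qed.

(** * Integer vectors *)

Definition vec : Type := (int * int * int)%type.

Definition dot (v w : vec) : int :=
  v.1.1 * w.1.1 + v.1.2 * w.1.2 + v.2 * w.2.

Definition vcross (v w : vec) : vec :=
  (v.1.2 * w.2 - v.2 * w.1.2, v.2 * w.1.1 - v.1.1 * w.2,
   v.1.1 * w.1.2 - v.1.2 * w.1.1).

Definition scale (k : int) (v : vec) : vec := (k * v.1.1, k * v.1.2, k * v.2).

Definition norm (v : vec) : nat :=
  maxn (maxn `|v.1.1|%N `|v.1.2|%N) `|v.2|%N.

(** A vector is primitive when its content is 1. *)
Definition content (v : vec) : nat :=
  gcdn (gcdn `|v.1.1|%N `|v.1.2|%N) `|v.2|%N.

Lemma bezout3 v : exists al, dot al v = (content v)%:Z.
Proof.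
case: v => [[x y] z]; rewrite /dot /content /=.
have [a [b ab]] := Bezoutz x y; have [c [d cd]] := Bezoutz (gcdz x y) z.
exists (c * a, c * b, d); rewrite /= -[RHS]cd -ab /=; ring.
Qed.

Lemma content_dvd v : exists w, v = scale (content v)%:Z w.
Proof.
case: v => [[x y] z].
have H t : (content (x, y, z) %| `|t|)%N -> exists s, t = (content (x, y, z))%:Z * s.
  by move=> h; have /dvdzP[s ->] : ((content (x, y, z))%:Z %| t)%Z by []; exists s; rewrite mulrC.
have [|x' Ex] := H x; first by rewrite /content /= (dvdn_trans (dvdn_gcdl _ _)) ?dvdn_gcdl.
have [|y' Ey] := H y; first by rewrite /content /= (dvdn_trans (dvdn_gcdl _ _)) ?dvdn_gcdr.
have [|z' Ez] := H z; first by rewrite /content /= ?dvdn_gcdr.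
by exists (x', y', z'); rewrite /scale /= -Ex -Ey -Ez.
Qed.

Lemma content_scale k v : content (scale k v) = (absz k * content v)%N.
Proof. by rewrite /content /= !abszM !muln_gcdr. Qed.

Lemma content_eq0 v : (content v == 0%N) = (v == (0, 0, 0)).
Proof.
case: v => [[x y] z]; rewrite /content /= !xpair_eqE -!absz_eq0.
by rewrite !eqn0Ngt !gcdn_gt0 !negb_or.
Qed.

Lemma primitive_norm_gt0 v : content v = 1%N -> (0 < norm v)%N.
Proof.
move=> v1; rewrite lt0n; apply/eqP => v0; suff : content v = 0%N by rewrite v1.
by apply/eqP; rewrite content_eq0; case: v v0 {v1} => [[x y] z]; rewrite /norm /= !xpair_eqE; lia.
Qed.

(** Expanding [al x (v x w)] by the triple product identity gives
    [(al . w) v - (al . v) w], and the second coefficient is 1. *)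
Lemma parallel_scale al v w : dot al v = 1 -> vcross v w = (0, 0, 0) ->
  w = scale (dot al w) v.
Proof.
case: v w al => [[x y] z] [[x' y'] z'] [[a b] c]; rewrite /dot /scale /= => h [h1 h2 h3].
congr (_, _, _); apply/eqP; rewrite -subr_eq0 -[X in X - _]mul1r -h; apply/eqP.
- by transitivity (c * (z * x' - x * z') - b * (x * y' - y * x')); [ring | rewrite h2 h3; ring].
- by transitivity (a * (x * y' - y * x') - c * (y * z' - z * y')); [ring | rewrite h1 h3; ring].
- by transitivity (b * (y * z' - z * y') - a * (z * x' - x * z')); [ring | rewrite h1 h2; ring].
Qed.

(** * Lattice points in a plane *)

Definition irange (r : nat) : seq int :=
  [seq i%:Z - r%:Z | i <- iota 0 (2 * r).+1].

Lemma mem_irange r x : (x \in irange r) = (`|x| <= r)%N.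
Proof.
apply/mapP/idP => [[i]|h]; first by rewrite mem_iota => h ->; lia.
by exists (absz (x + r%:Z)); rewrite ?mem_iota; lia.
Qed.

Lemma irange_uniq r : uniq (irange r).
Proof. by rewrite map_inj_uniq ?iota_uniq // => i j; lia. Qed.

Lemma size_irange r : size (irange r) = (2 * r).+1.
Proof. by rewrite size_map size_iota. Qed.

Definition box (r : nat) : seq vec := prod3 (irange r) (irange r) (irange r).

Lemma mem_box r v : (v \in box r) = (norm v <= r)%N.
Proof. by case: v => [[x y] z]; rewrite mem_prod3 !mem_irange /norm !geq_max /= andbA. Qed.

Lemma box_uniq r : uniq (box r).
Proof. by rewrite uniq_prod3 ?irange_uniq. Qed.

Lemma size_box r : size (box r) = ((2 * r).+1 ^ 3)%N.
Proof. by rewrite size_prod3 size_irange !expnS expn0; lia. Qed.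

Lemma norm_vcross v w : (norm (vcross v w) <= 2 * norm v * norm w)%N.
Proof.
case: v w => [[x y] z] [[x' y'] z'].
have H (s t p q : int) A B : (`|s| <= A)%N -> (`|t| <= A)%N -> (`|p| <= B)%N -> (`|q| <= B)%N ->
  (absz (s * p - t * q)%R <= 2 * A * B)%N.
  move=> hs ht hp hq; apply: (@leq_trans (absz (s * p)%R + absz (t * q)%R)%N); first by lia.
  by rewrite !abszM -mulnA mul2n -addnn leq_add // leq_mul.
by rewrite /norm /= !geq_max !H // ?leq_max ?leqnn ?orbT.
Qed.

Lemma norm_scale k v : norm (scale k v) = (`|k| * norm v)%N.
Proof. by rewrite /norm /= !abszM !maxnMr. Qed.

Definition plane (M : nat) (w : vec) : seq vec := [seq x <- box M | dot w x == 0].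

(** Both factors of [vcross a x] are orthogonal to [w], so their vector
    product is a multiple of [w]; the multiplier is an integer because [w] is
    primitive. *)
Lemma vcross_plane al w a x : dot al w = 1 -> dot w a = 0 -> dot w x = 0 ->
  vcross a x = scale (dot al (vcross a x)) w.
Proof.
move=> h ha hx; apply: parallel_scale => //.
case: w a x ha hx {h} => [[x1 x2] x3] [[a1 a2] a3] [[b1 b2] b3]; rewrite /dot /vcross /= => ha hx.
congr (_, _, _); apply/eqP.
- rewrite (_ : _ - _ = a1 * (x1 * b1 + x2 * b2 + x3 * b3) -
    b1 * (x1 * a1 + x2 * a2 + x3 * a3)); last by ring.
  by rewrite ha hx; apply/eqP; ring.
- rewrite (_ : _ - _ = a2 * (x1 * b1 + x2 * b2 + x3 * b3) -
    b2 * (x1 * a1 + x2 * a2 + x3 * a3)); last by ring.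
  by rewrite ha hx; apply/eqP; ring.
- rewrite (_ : _ - _ = a3 * (x1 * b1 + x2 * b2 + x3 * b3) -
    b3 * (x1 * a1 + x2 * a2 + x3 * a3)); last by ring.
  by rewrite ha hx; apply/eqP; ring.
Qed.

Definition sub (v w : vec) : vec := (v.1.1 - w.1.1, v.1.2 - w.1.2, v.2 - w.2).

Lemma sub_eq0 v w : sub v w = (0, 0, 0) -> v = w.
Proof. by case: v w => [[x y] z] [[x' y'] z'] [] *; congr (_, _, _); lia. Qed.

Lemma vcross_subr a v w : vcross a (sub v w) = sub (vcross a v) (vcross a w).
Proof. by rewrite /vcross /sub /=; congr (_, _, _); ring. Qed.

(** The sup-norm is attained by one of the three coordinate functions; only the
    linearity of that function matters afterwards, not which one it is. *)
Lemma norm_coord v : exists p : vec -> int,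
  [/\ norm v = absz (p v), forall x, (absz (p x) <= norm x)%N,
      forall k x, p (scale k x) = k * p x & forall x y, p (sub x y) = p x - p y].
Proof.
have : [|| norm v == absz v.1.1, norm v == absz v.1.2 | norm v == absz v.2].
  by rewrite /norm; lia.
by case/or3P => /eqP h; [exists (fun x => x.1.1)|exists (fun x => x.1.2)|exists (fun x => x.2)];
  split=> // x; rewrite /norm; lia.
Qed.

(** Two integers that differ by a multiple of [a] and fall in the same interval
    of length [|a|] are equal. *)
Lemma same_quotient (M A : nat) (x y k a : int) :
  (0 < A)%N -> absz a = A -> (absz x <= M)%N -> (absz y <= M)%N ->
  (absz (x + M%:Z)%R %/ A = absz (y + M%:Z)%R %/ A)%N -> x - y = k * a -> k = 0.
Proof.
move=> A0 aA hx hy hq hk; apply/eqP; rewrite -absz_eq0.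
have : (absz k * A < A)%N.
  rewrite -aA -abszM -hk aA.
  have := divn_eq (absz (x + M%:Z)) A; have := divn_eq (absz (y + M%:Z)) A.
  have := ltn_pmod (absz (x + M%:Z)) A0; have := ltn_pmod (absz (y + M%:Z)) A0.
  by rewrite hq; lia.
by rewrite -[X in (_ < X)%N]mul1n ltn_pmul2r // ltnS leqn0.
Qed.

(** A point [x] of the plane is determined by two bounded integers.  The first
    is the multiplier [h] in [vcross a x = h w], at most [2 |a| M / |w|] in
    absolute value.  Points with the same [h] differ by multiples of the
    primitive vector [a], so [x] is then fixed by the interval of length [|a|]
    containing its largest coordinate along [a], one of at most [3 M / |a|].
    The product of the two ranges is free of [|a|].  The point [b], independent
    of [a], guarantees that [2 |a| M / |w|] is at least 1, so that the additive
    constants in the ranges can be absorbed. *)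
Lemma size_plane_le M w a b : content w = 1%N -> content a = 1%N ->
  a \in plane M w -> b \in plane M w -> vcross a b != (0, 0, 0) ->
  (size (plane M w) * norm w <= 18 * M ^ 2)%N.
Proof.
move=> w1 a1 aP bP ab.
have [al ha] := bezout3 a; rewrite a1 in ha.
have [om hw] := bezout3 w; rewrite w1 in hw.
have inP x : x \in plane M w -> (norm x <= M)%N /\ dot w x = 0.
  by rewrite mem_filter mem_box => /andP[/eqP].
have [aM aw] := inP _ aP; have [bM bw] := inP _ bP.
have crossE x : x \in plane M w -> vcross a x = scale (dot om (vcross a x)) w.
  by case/inP=> *; apply: vcross_plane.
have [p [pa pM pZ pB]] := norm_coord a.
have A0 := primitive_norm_gt0 a1; have W0 := primitive_norm_gt0 w1.
set A := norm a in pa A0 aM *; set W := norm w in W0 *.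
pose H := (2 * A * M %/ W)%N; pose Q := (2 * M %/ A)%N.
have hH x : x \in plane M w -> (absz (dot om (vcross a x)) <= H)%N.
  move=> xP; rewrite leq_divRL // -norm_scale -crossE //.
  by apply: leq_trans (norm_vcross _ _) _; rewrite leq_mul2l (inP _ xP).1 orbT.
(* Shifting by [M] makes the largest coordinate nonnegative before division. *)
pose f x := (dot om (vcross a x), (absz (p x + M%:Z)%R %/ A)%N).
have f_inj : {in plane M w &, injective f}.
  move=> x y xP yP [h1 h2]; apply: sub_eq0.
  have xy : vcross a (sub x y) = (0, 0, 0).
    by rewrite vcross_subr crossE // h1 -crossE // /sub !subrr.
  have hk := parallel_scale ha xy.
  suff k0 : dot al (sub x y) = 0 by rewrite hk k0 /scale !mul0r.
  apply: (@same_quotient M A (p x) (p y) _ (p a)) h2 _ => //.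
  - exact: leq_trans (pM x) (inP _ xP).1.
  - exact: leq_trans (pM y) (inP _ yP).1.
  - by rewrite -pB [X in p X]hk pZ.
have szK : (size (plane M w) <= (2 * H).+1 * Q.+1)%N.
  rewrite -(size_map f) -(size_irange H) -(size_iota 0 Q.+1) -(size_allpairs pair).
  apply: uniq_leq_size => [|_ /mapP[x xP ->]].
    by rewrite map_inj_in_uniq ?filter_uniq ?box_uniq.
  apply: allpairs_f; first by rewrite mem_irange hH.
  rewrite mem_iota /= add0n ltnS leq_div2r //.
  by have := leq_trans (pM x) (inP _ xP).1; lia.
have H1 : (0 < H)%N.
  rewrite (leq_trans _ (hH _ bP)) // lt0n absz_eq0; apply: contraNneq ab => e.
  by rewrite crossE // e /scale !mul0r.
have HW : (H * W <= 2 * A * M)%N := leq_trunc_div _ _.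
have QA : (Q.+1 * A <= 3 * M)%N by have : (Q * A <= 2 * M)%N := leq_trunc_div _ _; lia.
rewrite -(leq_pmul2r A0).
apply: (@leq_trans ((3 * H * Q.+1) * W * A)%N).
  by rewrite !leq_mul2r (leq_trans szK) ?orbT // leq_mul2r; apply/orP; right; lia.
rewrite (_ : (_ * A)%N = 3 * ((H * W) * (Q.+1 * A)))%N; last by ring.
apply: (@leq_trans (3 * ((2 * A * M) * (3 * M)))%N); first by rewrite leq_mul2l leq_mul.
by rewrite leq_eqVlt; apply/orP; left; apply/eqP; ring.
Qed.

(** * Counting coplanar triples *)

(** Two distinct edges of visible pairs that cross, with directions [a] and [b]
    and starting points differing by [c], give such a triple. *)
Definition coplanar (M : nat) : seq (vec * vec * vec) :=
  [seq t <- prod3 (box M) (box M) (box M) |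
    [&& content t.1.1 == 1%N, vcross t.1.1 t.1.2 != (0, 0, 0)
      & dot (vcross t.1.1 t.1.2) t.2 == 0]].

(** The common normal is [vcross a b] divided by its content. *)
Lemma coplanar_plane M a b c : (a, b, c) \in coplanar M ->
  exists w, [/\ content w = 1%N, (norm w <= 2 * M ^ 2)%N, a \in plane M w,
    b \in plane M w & c \in plane M w].
Proof.
rewrite mem_filter mem_prod3 !mem_box /= => /andP[/and3P[/eqP a1 ab /eqP abc] /and3P[aM bM cM]].
have [w hw] := content_dvd (vcross a b).
set g := content _ in hw.
have g0 : g != 0%N by rewrite content_eq0.
have Nw : (norm w <= norm (vcross a b))%N by rewrite hw norm_scale leq_pmull // lt0n.
have dw x : dot (vcross a b) x = 0 -> dot w x == 0.
  rewrite hw (_ : dot _ x = g%:Z * dot w x); last by rewrite /dot /scale /=; ring.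
  by move/eqP; rewrite mulf_eq0 => /orP[/eqP h|//]; move: g0; lia.
exists w; rewrite !mem_filter !mem_box aM bM cM !dw //; try by rewrite /dot /vcross /=; ring.
split=> //; last first.
  apply: leq_trans Nw (leq_trans (norm_vcross _ _) _).
  by rewrite expnS expn1 mulnA leq_mul // leq_mul2l aM orbT.
have : content (vcross a b) = (g * content w)%N by rewrite {1}hw content_scale.
rewrite -/g -{1}[g]muln1 => /eqP; rewrite eqn_pmul2l ?lt0n // => /eqP <- //.
Qed.

(** Passing from the box of radius [r] to that of radius [r + 1] adds at most
    [26 (r + 1)^2] vectors, each of norm [r + 1]. *)
Lemma sum_norm_le (R : realFieldType) (W : nat) :
  \sum_(w <- box W | (0 < norm w)%N) (norm w)%:R ^- 3 <= 26 * \sum_(i < W) (i.+1)%:R^-1 :> R.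
Proof.
elim: W => [|r IH].
  by rewrite big_ord0 mulr0 big_seq_cond big1 // => w; rewrite mem_box; lia.
rewrite big_ord_recr /= mulrDr (bigID (fun w => norm w <= r)%N) /= lerD //.
  apply: le_trans IH; rewrite le_eqVlt; apply/orP; left; apply/eqP.
  rewrite (eq_bigl (fun w => (norm w <= r)%N && (0 < norm w)%N)); last by move=> w; rewrite andbC.
  rewrite -big_filter_cond; apply: perm_big; apply: uniq_perm; rewrite ?filter_uniq ?box_uniq // => w.
  by rewrite mem_filter !mem_box; lia.
have hc : (count (fun w => norm w == r.+1) (box r.+1) <= 26 * r.+1 ^ 2)%N.
  have : (count (fun w => norm w == r.+1) (box r.+1) + size (box r) <= size (box r.+1))%N.
    rewrite -size_filter -size_cat; apply: uniq_leq_size.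
      rewrite cat_uniq filter_uniq ?box_uniq // andbT andTb; apply/hasPn => w.
      by rewrite mem_box mem_filter; lia.
    by move=> w; rewrite mem_cat mem_filter !mem_box; lia.
  by rewrite !size_box; nia.
rewrite big_seq_cond (eq_bigr (fun=> (r.+1)%:R ^- 3)); last first.
  by move=> w; rewrite mem_box => /and3P[h1 _ h2]; rewrite (_ : norm w = r.+1) //; lia.
rewrite (eq_bigl (fun w => (w \in box r.+1) && (norm w == r.+1))); last first.
  by move=> w; rewrite mem_box; lia.
rewrite -big_seq_cond big_const_seq iter_addr_0 -[X in X <= _]mulr_natr.
apply: (@le_trans _ _ (r.+1%:R ^- 3 * (26 * r.+1 ^ 2)%:R)).
  by rewrite ler_wpM2l ?ler_nat // invr_ge0 exprn_ge0.
rewrite natrM natrX le_eqVlt; apply/orP; left; apply/eqP.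
by field; rewrite addrC natr1 pnatr_eq0.
Qed.

(** Every triple lies in the cube of [plane M w] for some normal [w] to which
    [size_plane_le] applies, and then
    [size (plane M w) ^ 3 <= (18 M^2 / |w|) ^ 3]. *)
Lemma size_coplanar_le (R : realFieldType) (M : nat) : (size (coplanar M))%:R <=
  26 * 18 ^+ 3 * M%:R ^+ 6 * \sum_(i < 2 * M ^ 2) (i.+1)%:R^-1 :> R.
Proof.
pose good w := (content w == 1%N) && (size (plane M w) * norm w <= 18 * M ^ 2)%N.
pose s := flatten [seq prod3 (plane M w) (plane M w) (plane M w) | w <- box (2 * M ^ 2) & good w].
have ss : (size (coplanar M) <= size s)%N.
  apply: uniq_leq_size => [|[[a b] c] abc].
    by rewrite filter_uniq // uniq_prod3 ?box_uniq.
  have [w [w1 wW aw bw cw]] := coplanar_plane abc.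
  apply/flatten_mapP; exists w; last by rewrite mem_prod3 aw bw.
  rewrite mem_filter mem_box wW andbT /good w1 /=.
  move: abc; rewrite mem_filter /= => /andP[/and3P[/eqP a1 ab _] _].
  exact: (size_plane_le w1 a1 aw bw ab).
apply: (@le_trans _ _ (size s)%:R); first by rewrite ler_nat.
rewrite size_flatten /shape -map_comp sumnE big_map natr_sum big_filter.
apply: (@le_trans _ _ ((18 ^+ 3 * M%:R ^+ 6) *
  \sum_(w <- box (2 * M ^ 2) | (0 < norm w)%N) (norm w)%:R ^- 3)); last first.
  rewrite [X in _ <= X](_ : _ = (18 ^+ 3 * M%:R ^+ 6) *
    (26 * \sum_(i < 2 * M ^ 2) (i.+1)%:R^-1)); last by ring.
  by rewrite ler_wpM2l ?sum_norm_le // mulr_ge0 ?exprn_ge0.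
rewrite mulr_sumr big_mkcond [X in _ <= X]big_mkcond /=.
apply: ler_sum => w _; rewrite /good.
case: ifP => [/andP[/eqP w1 h]|_]; last by case: ifP => // _; rewrite !mulr_ge0 ?invr_ge0 ?exprn_ge0.
have W0 := primitive_norm_gt0 w1.
rewrite W0 ler_pdivlMr ?exprn_gt0 ?ltr0n // size_prod3.
rewrite -!natrX -!natrM ler_nat.
rewrite (_ : (_ * _)%N = (size (plane M w) * norm w) ^ 3)%N; last by ring.
apply: (@leq_trans ((18 * M ^ 2) ^ 3)%N); first by rewrite leq_exp2r.
by rewrite leq_eqVlt; apply/orP; left; apply/eqP; ring.
Qed.

Lemma ln_ge_1V (R : realType) (x : R) : 0 < x -> 1 - x^-1 <= ln x.
Proof.
move=> x0; rewrite -[x in ln x]invrK lnV ?posrE ?invr_gt0 // lerNr opprB.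
have := @le_ln1Dx R (x^-1 - 1); rewrite addrCA subrr addr0; apply.
by rewrite -subr_gt0 opprK subrK invr_gt0.
Qed.

Lemma harmonic_le (R : realType) (n : nat) : (0 < n)%N ->
  \sum_(i < n) (i.+1)%:R^-1 <= 1 + ln n%:R :> R.
Proof.
elim: n => // -[_ _|n /(_ isT) IH _]; first by rewrite big_ord1 ln1 invr1 addr0.
rewrite big_ord_recr /=; apply: le_trans (lerD IH (lexx _)) _.
rewrite -addrA lerD2l -lerBrDl -ln_div ?posrE ?ltr0n //.
apply: le_trans (ln_ge_1V _); last by rewrite divr_gt0 ?ltr0n.
rewrite invf_div -[n.+2]addn1 natrD le_eqVlt; apply/orP; left; apply/eqP.
by field; rewrite [1 + _]addrC !natr1 pnatr_eq0.
Qed.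

Lemma size_coplanar_le_ln (R : realType) (M : nat) : (0 < M)%N ->
  (size (coplanar M))%:R <=
  26 * 18 ^+ 3 * M%:R ^+ 6 * (1 + ln (2 * M%:R ^+ 2)) :> R.
Proof.
move=> M0; apply: le_trans (size_coplanar_le R M) _.
rewrite ler_wpM2l ?mulr_ge0 ?exprn_ge0 // -natrX -natrM.
by apply: harmonic_le; rewrite muln_gt0 expn_gt0 M0.
Qed.

(** * Visible pairs in a cube *)

Definition npoint : Type := (nat * nat * nat)%type.

Definition diff (u v : npoint) : vec :=
  (v.1.1%:Z - u.1.1%:Z, v.1.2%:Z - u.1.2%:Z, v.2%:Z - u.2%:Z).

Definition cube (n : nat) : seq npoint := prod3 (iota 1 n) (iota 1 n) (iota 1 n).

Definition visible_pairs (n L : nat) : seq (npoint * npoint) :=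
  [seq p <- [seq (u, v) | u <- cube n, v <- cube n] |
    (content (diff p.1 p.2) == 1%N) && (norm (diff p.1 p.2) <= L)%N].

Definition residue_class (lo L d x : nat) : seq nat :=
  [seq y <- iota lo L | (d %| absz (y%:Z - x%:Z)%R)%N].

Lemma size_residue_class lo L d x : (0 < d)%N -> (0 < L)%N ->
  (size (residue_class lo L d x) <= (L.-1 %/ d).+1)%N.
Proof.
move=> d0 L0; rewrite -(size_iota 0 (L.-1 %/ d).+1).
rewrite -(size_map (fun y => (y - lo) %/ d)%N).
apply: uniq_leq_size => [|_ /mapP[y yC ->]]; last first.
  move: yC; rewrite mem_filter !mem_iota /= => /andP[_ h].
  by rewrite add0n ltnS leq_div2r //; lia.
rewrite map_inj_in_uniq ?filter_uniq ?iota_uniq // => y z.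
rewrite !mem_filter !mem_iota => /andP[dy hy] /andP[dz hz] hq.
have hd : (d %| absz (y%:Z - z%:Z))%N.
  rewrite (_ : y%:Z - z%:Z = (y%:Z - x%:Z) - (z%:Z - x%:Z)); last by ring.
  have h1 : (d%:Z %| (y%:Z - x%:Z)%R)%Z by [].
  have h2 : (d%:Z %| (z%:Z - x%:Z)%R)%Z by [].
  exact: rpredB h1 h2.
have : (absz (y%:Z - z%:Z)%R < d)%N.
  have := divn_eq (y - lo) d; have := divn_eq (z - lo) d.
  have := ltn_pmod (y - lo) d0; have := ltn_pmod (z - lo) d0.
  by rewrite hq; lia.
case: (posnP (absz (y%:Z - z%:Z)%R)) => [|h0]; first by lia.
by rewrite ltnNge (dvdn_leq h0 hd).
Qed.

(** Expand the cube and telescope, using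
    [1/d^3 <= 1/((d-1)d(d+1))] and [1/d^2 <= 1/((d-1)d)] for [d = i + 2]. *)
Lemma sum_cube_le (F : realFieldType) (L k : nat) :
  \sum_(i < k) (L%:R / (i.+2)%:R + 1) ^+ 3 <=
  L%:R ^+ 3 * (1 / 4 - (2 * k.+1%:R * k.+2%:R)^-1) + 3 * L%:R ^+ 2 * (1 - k.+1%:R^-1)
  + (3 / 2 * L%:R + 1) * k%:R :> F.
Proof.
elim: k => [|k IH]; first by rewrite big_ord0 !mulrnAr; lra.
rewrite big_ord_recr /=; apply: le_trans (lerD IH (lexx _)) _.
have [l l0] : exists l : F, l = L%:R /\ 0 <= l by exists L%:R.
have [t [t0 t1]] : exists t : F, t = k%:R /\ 0 <= t by exists k%:R.
rewrite -[k.+3]addn3 -[k.+2]addn2 -[k.+1]addn1 !natrD -t0 -l0.1.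
case: l0 => _ l0.
have e1 : (l / (t + 2) + 1) ^+ 3 =
    l ^+ 3 / (t + 2) ^+ 3 + 3 * l ^+ 2 / (t + 2) ^+ 2 + 3 * l / (t + 2) + 1.
  by field; lra.
have e2 : l ^+ 3 / (t + 2) ^+ 3 <=
    l ^+ 3 * ((2 * (t + 1) * (t + 2))^-1 - (2 * (t + 2) * (t + 3))^-1).
  rewrite ler_wpM2l ?exprn_ge0 //.
  rewrite (_ : _ - _ = ((t + 1) * (t + 2) * (t + 3))^-1); last by field; lra.
  by rewrite lef_pV2 ?posrE ?exprn_gt0 ?mulr_gt0 //; lra.
have e3 : 3 * l ^+ 2 / (t + 2) ^+ 2 <= 3 * l ^+ 2 * ((t + 1)^-1 - (t + 2)^-1).
  rewrite ler_wpM2l ?mulr_ge0 ?exprn_ge0 //.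
  rewrite (_ : _ - _ = ((t + 1) * (t + 2))^-1); last by field; lra.
  by rewrite lef_pV2 ?posrE ?exprn_gt0 ?mulr_gt0 //; lra.
have e4 : 3 * l / (t + 2) <= 3 / 2 * l.
  by rewrite ler_pdivrMr; [have := mulr_ge0 l0 t1; lra | lra].
rewrite e1; lra.
Qed.

Lemma sum_class_le_aux (F : realFieldType) (L : nat) : (0 < L)%N ->
  4 * \sum_(i < L.-1) (L%:R / (i.+2)%:R + 1) ^+ 3 <= L%:R ^+ 3 + 20 * L%:R ^+ 2 :> F.
Proof.
move=> L0; apply: le_trans (ler_wpM2l _ (sum_cube_le _ L L.-1)) _ => //.
rewrite prednK // -(addn1 L) natrD (_ : L.-1%:R = L%:R - 1 :> F); last first.
  by rewrite -[in RHS](prednK L0) -natr1 addrK.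
have : 1 <= L%:R :> F by rewrite ler1n.
move: (L%:R) => t t1.
have : 0 <= t ^+ 3 * (2 * t * (t + 1))^-1.
  by rewrite mulr_ge0 ?invr_ge0 ?exprn_ge0 ?mulr_ge0 //; lra.
have : 0 <= t ^+ 2 * t^-1.
  by rewrite mulr_ge0 ?invr_ge0 ?exprn_ge0 //; lra.
have : 0 <= t ^+ 2 by rewrite sqr_ge0.
move: ((2 * t * _)^-1) (t^-1) => X Y.
lra.
Qed.

(** The main term [L^3/4] comes from the sum of [1/d^3] over [d >= 2]: at most
    about a quarter of the points of a cube of side [L] are hidden from a given
    point. *)
Lemma sum_class_le (L : nat) : (0 < L)%N ->
  (4 * \sum_(i < L.-1) ((L.-1 %/ i.+2).+1) ^ 3 <= L ^ 3 + 20 * L ^ 2)%N.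
Proof.
move=> L0; rewrite -(ler_nat rat) natrM natrD natrM !natrX natr_sum.
apply: le_trans (sum_class_le_aux _ L0).
rewrite ler_pM2l ?ltr0n //; apply: ler_sum => i _.
rewrite natrX lerXn2r ?nnegrE ?addr_ge0 ?divr_ge0 // -natr1 lerD2r.
rewrite ler_pdivlMr ?ltr0n // -natrM ler_nat.
by apply: leq_trans (leq_trunc_div _ _) (leq_pred _).
Qed.

(** Only the points [v] of a subcube of side [L] that contains [u] are counted.
    If [v] is not visible from [u], some [d] with [1 < d <= L] divides all
    coordinate differences, so [v] lies in a product of three residue classes
    modulo [d], each with at most [(L - 1)/d + 1] elements in its side of the
    subcube. *)
Lemma count_visible n L u : u \in cube n -> (1 < L <= n)%N ->
  (3 * L ^ 3 <= 4 * count (fun v => (content (diff u v) == 1%N) &&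
     (norm (diff u v) <= L)%N) (cube n) + 20 * L ^ 2)%N.
Proof.
case: u => [[x y] z]; rewrite mem_prod3 !mem_iota => /and3P[hx hy hz] /andP[L1 Ln].
(* The side of the subcube starts at [t] unless it would leave [1..n]. *)
pose lo t := minn t (n.+1 - L).
pose B : seq npoint := prod3 (iota (lo x) L) (iota (lo y) L) (iota (lo z) L).
have BU : uniq B by rewrite uniq_prod3 ?iota_uniq.
have inB a b c : (a, b, c) \in B -> (a, b, c) \in cube n /\ (norm (diff (x, y, z) (a, b, c)) < L)%N.
  rewrite !mem_prod3 !mem_iota /norm /= /lo => h; split; lia.
pose vis v := content (diff (x, y, z) v) == 1%N.
have szB : (count vis B + count (predC vis) B)%N = (L ^ 3)%N.
  by rewrite count_predC size_prod3 !size_iota; ring.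
have h1 : (count vis B <= count (fun v => vis v && (norm (diff (x, y, z) v) <= L)%N) (cube n))%N.
  rewrite -!size_filter; apply: uniq_leq_size; first by rewrite filter_uniq.
  by move=> [[a b] c]; rewrite !mem_filter => /andP[-> /inB[-> /ltnW ->]].
pose cls d : seq npoint := prod3 (residue_class (lo x) L d x)
  (residue_class (lo y) L d y) (residue_class (lo z) L d z).
have h2 : (count (predC vis) B <= \sum_(i < L.-1) ((L.-1 %/ i.+2).+1) ^ 3)%N.
  apply: (@leq_trans (\sum_(i < L.-1) size (cls i.+2))%N); last first.
    apply: leq_sum => i _; rewrite size_prod3 !expnS expn0 muln1 mulnA.
    by rewrite !leq_mul ?size_residue_class // ltnW.
  rewrite -size_filter -(big_mkord xpredT (fun i => size (cls i.+2))).
  have -> : (\sum_(0 <= i < L.-1) size (cls i.+2))%N =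
      size (flatten [seq cls i.+2 | i <- iota 0 L.-1]).
    by rewrite size_flatten /shape -map_comp sumnE big_map /index_iota subn0.
  apply: uniq_leq_size; first by rewrite filter_uniq.
  move=> [[a b] c]; rewrite mem_filter /= => /andP[nv abc].
  have [_ near] := inB _ _ _ abc.
  have [d [d2 dL da [db dc]]] : exists d, [/\ (1 < d)%N, (d <= L)%N,
      (d %| absz (a%:Z - x%:Z)%R)%N & (d %| absz (b%:Z - y%:Z)%R)%N /\
      (d %| absz (c%:Z - z%:Z)%R)%N].
    (* The point itself has content 0; it is counted with the divisor 2. *)
    have [e|ne] := eqVneq (norm (diff (x, y, z) (a, b, c))) 0%N.
      have [-> -> ->] : [/\ a = x, b = y & c = z] by move: e; rewrite /norm /=; split; lia.
      by exists 2%N; rewrite !subrr.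
    exists (content (diff (x, y, z) (a, b, c))).
    have c0 : content (diff (x, y, z) (a, b, c)) != 0%N.
      rewrite content_eq0; apply: contraNneq ne => e; by rewrite e.
    have [w hw] := content_dvd (diff (x, y, z) (a, b, c)).
    split; first by rewrite ltn_neqAle lt0n c0 andbT eq_sym.
    - apply: leq_trans (ltnW near).
      rewrite {2}hw norm_scale leq_pmulr // lt0n; apply: contraNneq ne => e.
      by rewrite hw norm_scale e muln0.
    - by rewrite /content /= (dvdn_trans (dvdn_gcdl _ _)) ?dvdn_gcdl.
    - by rewrite /content /= (dvdn_trans (dvdn_gcdl _ _)) ?dvdn_gcdr.
  apply/flatten_mapP; exists (d - 2)%N; first by rewrite mem_iota; lia.
  move: abc; rewrite !mem_prod3 => /and3P[ha hb hc].
  by rewrite -(addn2 (d - 2)) subnK // !mem_filter da db dc ha hb hc.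
have := sum_class_le (ltnW L1).
move: h1 h2 szB; rewrite /vis /=.
set S := (\sum_(i < L.-1) _)%N.
lia.
Qed.

Lemma size_visible_pairs n L : (1 < L <= n)%N ->
  (3 * n ^ 3 * L ^ 3 <= 4 * size (visible_pairs n L) + 20 * n ^ 3 * L ^ 2)%N.
Proof.
move=> hL.
have -> : size (visible_pairs n L) = (\sum_(u <- cube n)
    count (fun v => (content (diff u v) == 1%N) && (norm (diff u v) <= L)%N) (cube n))%N.
  rewrite size_filter count_flatten sumnE !big_map; apply: eq_bigr => u _.
  by rewrite count_map.
have sz : size (cube n) = (n ^ 3)%N by rewrite size_prod3 size_iota; ring.
have -> : (3 * n ^ 3 * L ^ 3 = \sum_(u <- cube n) (3 * L ^ 3))%N.
  by rewrite big_const_seq count_predT iter_addn_0 sz; ring.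
have -> : (20 * n ^ 3 * L ^ 2 = \sum_(u <- cube n) (20 * L ^ 2))%N.
  by rewrite big_const_seq count_predT iter_addn_0 sz; ring.
rewrite big_distrr -big_split /= big_seq [leqRHS]big_seq.
by apply: leq_sum => u uC; apply: count_visible.
Qed.

(** * Segments between lattice points *)

Definition pt (v : npoint) : 'rV[nat]_3 :=
  \row_(i < 3) nth 0%N [:: v.1.1; v.1.2; v.2] i.

Definition edge_of (p : npoint * npoint) : {fset 'rV[nat]_3} := [fset pt p.1; pt p.2].

Lemma pt_inj : injective pt.
Proof.
move=> [[x y] z] [[x' y'] z'] h.
have e i := congr1 (fun m : 'rV_3 => m ord0 i) h.
have := e ord0; have := e (inord 1); have := e (inord 2).
by rewrite !mxE /= !inordK //= => -> -> ->.
Qed.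

Lemma fset2_eq (T : choiceType) (a b c d : T) : [fset a; b] = [fset c; d] ->
  (a = c /\ b = d) \/ (a = d /\ b = c).
Proof.
move=> h.
have ha : a \in [fset c; d] by rewrite -h fset21.
have hb : b \in [fset c; d] by rewrite -h fset22.
have hc : c \in [fset a; b] by rewrite h fset21.
have hd : d \in [fset a; b] by rewrite h fset22.
move: ha hb hc hd; rewrite !in_fset2.
case/orP=> /eqP ->; case/orP=> /eqP -> ; rewrite ?eqxx ?orbb.
- by move=> _ /eqP ->; left.
- by left.
- by right.
- by move=> /eqP ->; left.
Qed.

Definition rev_pair (p : npoint * npoint) := (p.2, p.1).

Lemma edge_of_rev p : edge_of (rev_pair p) = edge_of p.
Proof. exact: fsetUC. Qed.

Lemma edge_of_eq p q : edge_of p = edge_of q -> p = q \/ p = rev_pair q.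
Proof.
case: p q => [u v] [u' v'] /fset2_eq /= [] [/pt_inj -> /pt_inj ->];
  by [left|right].
Qed.

(** The affine combination [(1 - t) p.1 + t p.2], written with the integer
    direction [diff p.1 p.2], to which Bezout arguments apply. *)
Definition on_line_at (R : realType) (p : npoint * npoint) (t : R) (r : 'rV[R]_3) : Prop :=
  [/\ r ord0 (inord 0) = p.1.1.1%:R + t * (diff p.1 p.2).1.1%:~R,
      r ord0 (inord 1) = p.1.1.2%:R + t * (diff p.1 p.2).1.2%:~R &
      r ord0 (inord 2) = p.1.2%:R + t * (diff p.1 p.2).2%:~R].

(** An edge is an unordered pair, so its segment is parametrised from one of the
    two endpoints, not necessarily from [p.1]. *)
Lemma edge_segment_on_line (R : realType) p (r : 'rV[R]_3) : edge_segment R (edge_of p) r ->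
  exists q t, [/\ edge_of q = edge_of p, q = p \/ q = rev_pair p, 0 < t < 1 & on_line_at q t r].
Proof.
case=> [x [y [h [t [t01 ->]]]]].
have [q [qp ex ey]] : exists q, [/\ q = p \/ q = rev_pair p, x = pt q.1 & y = pt q.2].
  have [[<- <-]|[<- <-]] := fset2_eq h; first by exists p; split=> //; left.
  by exists (rev_pair p); split=> //; right.
exists q, t; split=> //; first by case: qp => ->; rewrite ?edge_of_rev.
by rewrite ex ey; split; rewrite !mxE inordK //= intrD intrN -!pmulrn; ring.
Qed.

Lemma real_point_on_line (R : realType) v p (t : R) : on_line_at p t (real_point R (pt v)) ->
  [/\ (diff p.1 v).1.1%:~R = t * (diff p.1 p.2).1.1%:~R,
      (diff p.1 v).1.2%:~R = t * (diff p.1 p.2).1.2%:~R &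
      (diff p.1 v).2%:~R = t * (diff p.1 p.2).2%:~R].
Proof.
by case; rewrite !mxE !inordK //= => h1 h2 h3;
  split; rewrite intrD intrN -!pmulrn ?h1 ?h2 ?h3 addrC addKr.
Qed.

(** An integer multiple of a primitive vector by a real number is an integer
    multiple: by Bezout the number is an integer combination of coordinates. *)
Lemma primitive_scalar (R : realType) (a c : vec) (t : R) : content a = 1%N ->
  [/\ c.1.1%:~R = t * a.1.1%:~R, c.1.2%:~R = t * a.1.2%:~R &
      c.2%:~R = t * a.2%:~R] -> exists k : int, t = k%:~R /\ c = scale k a.
Proof.
move=> a1 [h1 h2 h3]; have [al] := bezout3 a; rewrite a1 => hal.
have tE : t = (dot al c)%:~R.
  rewrite /dot !intrD !intrM h1 h2 h3.
  transitivity (t * (dot al a)%:~R); first by rewrite hal mulr1.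
  by rewrite /dot !intrD !intrM; ring.
exists (dot al c); split=> //; move: h1 h2 h3; rewrite tE -!intrM.
by case: (c) => [[x y] z] /= /intr_inj h1 /intr_inj h2 /intr_inj h3; rewrite /scale -h1 -h2 -h3.
Qed.

Lemma int_open01 (R : realType) (k : int) : 0 < (k%:~R : R) < 1 -> False.
Proof. by rewrite ltr0z ltrz1; lia. Qed.

Lemma visible_proper (R : realType) v p : content (diff p.1 p.2) = 1%N ->
  ~ edge_segment R (edge_of p) (real_point R (pt v)).
Proof.
move=> p1 /edge_segment_on_line[q [t [_ qp t01 /real_point_on_line h]]].
have q1 : content (diff q.1 q.2) = 1%N.
  case: qp => -> //; rewrite -p1 /content /diff /=.
  by congr (gcdn (gcdn _ _) _); lia.
by have [k [tk _]] := primitive_scalar q1 h; move: t01; rewrite tk => /int_open01.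
Qed.

(** * Crossing segments *)

(** For segments leaving [u] and [v] in directions [a] and [b], with [c = v - u],
    this says that [u + t a = v + s b]. *)
Definition meets_at (R : realType) (a b c : vec) (t s : R) : Prop :=
  [/\ c.1.1%:~R = t * a.1.1%:~R - s * b.1.1%:~R,
      c.1.2%:~R = t * a.1.2%:~R - s * b.1.2%:~R &
      c.2%:~R = t * a.2%:~R - s * b.2%:~R].

Lemma edges_cross_meets_at (R : realType) p q :
  edges_cross R (edge_of p) (edge_of q) -> exists p' q' (t s : R),
  [/\ edge_of p' = edge_of p /\ (p' = p \/ p' = rev_pair p),
      edge_of q' = edge_of q /\ (q' = q \/ q' = rev_pair q), 0 < t < 1, 0 < s < 1 &
      meets_at (diff p'.1 p'.2) (diff q'.1 q'.2) (diff p'.1 q'.1) t s].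
Proof.
case=> r [/edge_segment_on_line[p' [t [ep pp t01 hp]]] /edge_segment_on_line[q' [s [eq qq s01 hq]]]].
exists p', q', t, s; split=> //.
case: hp hq => p1 p2 p3 [q1 q2 q3]; split; rewrite {1}/diff /= intrD intrN -!pmulrn.
- by move: p1 q1 => -> /=; lra.
- by move: p2 q2 => -> /=; lra.
- by move: p3 q3 => -> /=; lra.
Qed.

Lemma meets_at_coplanar (R : realType) a b c (t s : R) : meets_at a b c t s ->
  dot (vcross a b) c = 0.
Proof.
case=> h1 h2 h3; apply/eqP; rewrite -(intr_eq0 R) /dot /vcross /=.
rewrite !(intrD, intrM, intrN) h1 h2 h3; apply/eqP; ring.
Qed.

Lemma meets_at_norm (R : realType) a b c (t s : R) L : 0 < t < 1 -> 0 < s < 1 ->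
  meets_at a b c t s -> (norm a <= L)%N -> (norm b <= L)%N -> (norm c <= 2 * L)%N.
Proof.
move=> t01 s01 [h1 h2 h3].
have H (x y z : int) : z%:~R = t * x%:~R - s * y%:~R -> (absz x <= L)%N -> (absz y <= L)%N ->
    (absz z <= 2 * L)%N.
  move=> hz hx hy; have : - (2 * L)%:Z <= z <= (2 * L)%:Z; last by lia.
  rewrite -2!(ler_int R) hz rmorphN /= -pmulrn natrM.
  have : - (L%:Z)%:~R <= (x%:~R : R) <= (L%:Z)%:~R by rewrite -mulrNz !ler_int; lia.
  have : - (L%:Z)%:~R <= (y%:~R : R) <= (L%:Z)%:~R by rewrite -mulrNz !ler_int; lia.
  rewrite -!pmulrn; move: (x%:~R) (y%:~R) (L%:R) => u v l /andP[v1 v2] /andP[u1 u2].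
  case/andP: t01 s01 => t0 t1 /andP[s0 s1].
  have := ler_wpM2l (ltW t0) u1; have := ler_wpM2l (ltW t0) u2.
  have := ler_wpM2l (ltW s0) v1; have := ler_wpM2l (ltW s0) v2.
  have l0 : 0 <= l by lra.
  have : t * l <= l by rewrite ler_piMl // ltW.
  have : s * l <= l by rewrite ler_piMl // ltW.
  lra.
rewrite /norm !geq_max => /andP[/andP[a1 a2] a3] /andP[/andP[b1 b2] b3].
by rewrite (H _ _ _ h1) ?(H _ _ _ h2) ?(H _ _ _ h3).
Qed.

(** Here [b = a] or [b = - a], so [c] is an integer multiple of [a] whose
    multiplier is [t - s], of absolute value less than 1, or [t + s], strictly
    between 0 and 2. *)
Lemma meets_at_parallel (R : realType) a b c (t s : R) : 0 < t < 1 -> 0 < s < 1 ->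
  meets_at a b c t s -> content a = 1%N -> content b = 1%N -> vcross a b = (0, 0, 0) ->
  (b = a /\ c = (0, 0, 0)) \/ (b = scale (-1) a /\ c = a).
Proof.
move=> t01 s01 h a1 b1 ab.
have [al ha] := bezout3 a; rewrite a1 in ha.
have := parallel_scale ha ab; move: (dot al b) => k hk.
have k1 : absz k = 1%N by move: b1; rewrite hk content_scale a1 muln1.
have hc : [/\ c.1.1%:~R = (t - s * k%:~R) * a.1.1%:~R, c.1.2%:~R = (t - s * k%:~R) * a.1.2%:~R &
      c.2%:~R = (t - s * k%:~R) * a.2%:~R].
  by case: h => -> -> ->; rewrite hk /= !intrM; split; ring.
have [j [hj ->]] := primitive_scalar a1 hc.
have [k1'|k1'] : k = 1 \/ k = -1 by lia.
- left; rewrite hk k1' /scale !mul1r; split; first by case: (a) => [[]].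
  suff -> : j = 0 by rewrite !mul0r.
  have : (-1)%:~R < (j%:~R : R) < 1%:~R by rewrite -hj k1' mulrN1z; lra.
  by rewrite !ltr_int; lia.
- right; rewrite hk k1'; split=> //.
  suff -> : j = 1 by rewrite /scale !mul1r; case: (a) => [[]].
  have : 0%:~R < (j%:~R : R) < 2%:~R by rewrite -hj k1' mulrN1z; lra.
  by rewrite !ltr_int; lia.
Qed.

Lemma diff_inj u v w : diff u v = diff u w -> v = w.
Proof.
case: u v w => [[x y] z] [[x' y'] z'] [[x2 y2] z2] []; rewrite /= => *.
by congr (_, _, _); lia.
Qed.

Lemma crossing_parallel_eq (R : realType) p q (t s : R) : 0 < t < 1 -> 0 < s < 1 ->
  meets_at (diff p.1 p.2) (diff q.1 q.2) (diff p.1 q.1) t s ->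
  content (diff p.1 p.2) = 1%N -> content (diff q.1 q.2) = 1%N ->
  vcross (diff p.1 p.2) (diff q.1 q.2) = (0, 0, 0) -> edge_of p = edge_of q.
Proof.
case: p q => [u u'] [v v'] /= t01 s01 h h1 h2 h3.
have [[e0 e1]|[e0 e1]] := meets_at_parallel t01 s01 h h1 h2 h3.
- have uv : u = v.
    by apply: (@diff_inj u); rewrite e1 /diff !subrr.
  by move: e0; rewrite uv => /diff_inj ->.
- have vu := diff_inj e1; rewrite -vu in e0 *.
  suff -> : v' = u by rewrite -[RHS]edge_of_rev.
  apply: (@diff_inj v); rewrite e0 /diff /scale /=.
  by congr (_, _, _); ring.
Qed.

(** * Graphs of visible pairs *)

Definition grid (X Y Z : nat) : seq npoint := prod3 (iota 1 X) (iota 1 Y) (iota 1 Z).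

(** Visible pairs give proper edges, so any [m] of them form a graph. *)
Lemma exists_visible_graph (R : realType) X Y Z (s : seq (npoint * npoint)) m :
  (0 < X)%N -> (0 < Y)%N -> (0 < Z)%N ->
  {in s, forall p, [/\ p.1 \in grid X Y Z, p.2 \in grid X Y Z & content (diff p.1 p.2) = 1%N]} ->
  (m <= #|` [fset edge_of p | p in s]|)%N ->
  exists G : grid_graph R 3, cr_admissible (X * Y * Z) m G /\
    forall e, e \in edges G -> exists2 p, p \in s & e = edge_of p.
Proof.
move=> X0 Y0 Z0 hs; set E := [fset edge_of p | p in s] => mE.
pose V := [fset pt v | v in grid X Y Z].
pose E' := [fset e in take m (enum_fset E)].
have E'E e : e \in E' -> exists2 p, p \in s & e = edge_of p.
  rewrite !inE /= => /mem_take; move/imfsetP => [p /= ps ->]; by exists p.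
have gt0 x : x \in V -> forall i, (0 < x ord0 i)%N.
  move=> /imfsetP[[[a b] c] /= + ->] i; rewrite mem_prod3 !mem_iota => /and3P[ha hb hc].
  by rewrite mxE; case: i => [[|[|[|]]]] //= _; lia.
have simple e : e \in E' -> e `<=` V /\ #|` e| = 2%N.
  move=> /E'E[p /hs[p1 p2 p3] ->]; split.
    by apply/fsubsetP => x; rewrite !inE => /orP[] /eqP ->; apply/imfsetP; [exists p.1|exists p.2].
  rewrite cardfs2; case: eqP => // /pt_inj pp.
  by move: p3; rewrite pp /content /diff /= !subrr.
have proper e x : e \in E' -> x \in V -> ~ edge_segment R e (real_point R x).
  by move=> /E'E[p /hs[_ _ p3] ->] /imfsetP[v _ ->]; apply: visible_proper.
exists (GridGraph gt0 simple proper); split; last exact: E'E.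
split=> /=.
  rewrite card_fseq undup_id ?take_uniq ?fset_uniq // size_take.
  by case: ltngtP mE => // _ _.
pose S (i : 'I_3) := nth 0%N [:: X; Y; Z] i.
apply: (@leq_trans (\prod_(i < 3) S i)%N); last by rewrite !big_ord_recl big_ord0 /S /= muln1 mulnA.
apply: leq_prod => i _; apply: grid_side_min => {i}.
  by case=> [[|[|[|]]]].
move=> x /imfsetP[[[a b] c] /= + ->] i; rewrite mem_prod3 !mem_iota => /and3P[ha hb hc].
by rewrite mxE /S; case: i => [[|[|[|]]]] //= _; lia.
Qed.

(** A function increasing along every pair rules out that both orientations of
    an edge are listed. *)
Lemma card_oriented_edges (key : npoint -> nat) (s : seq (npoint * npoint)) : uniq s ->
  {in s, forall p, key p.1 < key p.2}%N -> #|` [fset edge_of p | p in s]| = size s.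
Proof.
move=> us ks; rewrite card_in_imfset /= ?undup_id // => p q ps qs.
case/edge_of_eq => // pq; have := ks _ ps; have := ks _ qs; rewrite pq /=; lia.
Qed.

Lemma is_cr_min_le (R : realType) d N m (G : grid_graph R d) : cr_admissible N m G ->
  exists k, is_cr_min R d N m k /\ (k <= cr G)%N.
Proof.
move=> hG; pose P k := `[< exists G' : grid_graph R d, cr_admissible N m G' /\ cr G' = k >].
have exP : exists k, P k by exists (cr G); apply/asboolP; exists G.
have [k /asboolP hk kmin] := ex_minnP exP.
have le (G' : grid_graph R d) : cr_admissible N m G' -> (k <= cr G')%N.
  by move=> hG'; apply: kmin; apply/asboolP; exists G'.
by exists k; split; [split|exact: le].
Qed.

Lemma cr_admissible_leq (R : realType) d N N' m (G : grid_graph R d) :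
  (N <= N')%N -> cr_admissible N m G -> cr_admissible N' m G.
Proof. by move=> h [? ?]; split=> //; apply: leq_trans h. Qed.

Lemma crossingsP (R : realType) d (G : grid_graph R d) c : c \in crossings G ->
  exists e f, [/\ e \in edges G, f \in edges G, e != f, c = [fset e; f] & edges_cross R e f].
Proof.
rewrite !inE /= fpowersetE => /andP[/fsubsetP cG /asboolP[e [f [ef cE h]]]].
by exists e, f; split=> //; apply: cG; rewrite cE ?fset21 ?fset22.
Qed.

Lemma cr_eq0 (R : realType) d (G : grid_graph R d) :
  (forall e f, e \in edges G -> f \in edges G -> edges_cross R e f -> e = f) -> cr G = 0%N.
Proof.
move=> h; apply/eqP; rewrite cardfs_eq0 -fsubset0; apply/fsubsetP => c.
by move=> /crossingsP[e [f [eG fG /eqP ef _ /(h _ _ eG fG)]]].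
Qed.

(** * Ladders *)

Definition rail (y k : nat) : seq (npoint * npoint) :=
  [seq ((i, y, 1%N), (i.+1, y, 1%N)) | i <- iota 1 k.-1].

Definition rungs (J : seq (nat * nat)) : seq (npoint * npoint) :=
  [seq ((ij.1, 1%N, 1%N), (ij.2, 2%N, 1%N)) | ij <- J].

(** Two parallel rows of [k] points joined along each row, with the rungs [J]
    between the rows; a rung is always a visible pair. *)
Definition ladder (J : seq (nat * nat)) (k : nat) : seq (npoint * npoint) :=
  rungs J ++ rail 1 k ++ rail 2 k.

Lemma size_ladder J k : size (ladder J k) = (size J + 2 * k.-1)%N.
Proof. by rewrite !size_cat !size_map size_iota; lia. Qed.

Lemma ladder_uniq J k : uniq J -> uniq (ladder J k).
Proof.
move=> uJ.
have rail_uniq y : uniq (rail y k) by rewrite map_inj_uniq ?iota_uniq // => i j [].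
have rungs_uniq : uniq (rungs J) by rewrite map_inj_uniq // => -[i j] [i' j'] [-> ->].
rewrite !cat_uniq rungs_uniq !rail_uniq andTb andbT.
apply/andP; split; apply/hasPn => p; rewrite ?mem_cat.
  by case/orP=> /mapP[i _ ->]; apply/negP => /mapP[j _ []].
by move=> /mapP[i _ ->]; apply/negP => /mapP[j _ []].
Qed.

Lemma exists_ladder_graph (R : realType) J k m : (0 < k)%N -> uniq J ->
  {in J, forall ij, (0 < ij.1 <= k)%N && (0 < ij.2 <= k)%N} ->
  (m <= size J + 2 * k.-1)%N ->
  exists G : grid_graph R 3, cr_admissible (k * 2) m G /\
    forall e, e \in edges G -> exists2 p, p \in ladder J k & e = edge_of p.
Proof.
move=> k0 uJ hJ hm; rewrite -[(k * 2)%N]muln1.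
apply: exists_visible_graph => //; last first.
  (* Row-major order: every listed pair goes forward. *)
  rewrite (@card_oriented_edges (fun v => v.1.1 + k.+1 * v.1.2)%N) ?ladder_uniq ?size_ladder //.
  move=> p; rewrite !mem_cat => /or3P[] /mapP.
  - by case=> -[i j] /hJ /= h ->; rewrite /=; lia.
  - by case=> i; rewrite mem_iota => h -> /=; lia.
  - by case=> i; rewrite mem_iota => h -> /=; lia.
move=> p; rewrite !mem_cat => /or3P[] /mapP.
- case=> -[i j] /hJ /= h -> /=; rewrite !mem_prod3 !mem_iota /=.
  by split; rewrite ?andbT; [lia|lia|rewrite /content /= gcdn1].
- case=> i; rewrite mem_iota => h -> /=.
  rewrite !mem_prod3 !mem_iota /=; split; rewrite ?andbT; try lia.
  by rewrite /content /= (_ : i.+1%:Z - i%:Z = 1) //; lia.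
- case=> i; rewrite mem_iota => h -> /=.
  rewrite !mem_prod3 !mem_iota /=; split; rewrite ?andbT; try lia.
  by rewrite /content /= (_ : i.+1%:Z - i%:Z = 1) //; lia.
Qed.

Lemma exists_path_graph (R : realType) k m : (0 < k)%N -> (m <= k.-1)%N ->
  exists G : grid_graph R 3, cr_admissible k m G.
Proof.
move=> k0 hm.
have [//|//|//|p||G] := @exists_visible_graph R k 1 1 (rail 1 k) m.
- case/mapP=> i; rewrite mem_iota => h -> /=.
  rewrite !mem_prod3 !mem_iota /=; split; rewrite ?andbT; try lia.
  by rewrite /content /= (_ : i.+1%:Z - i%:Z = 1) //; lia.
- rewrite (@card_oriented_edges (fun v => v.1.1)) ?map_inj_uniq ?iota_uniq ?size_map ?size_iota //.
    by move=> i j [].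
  by move=> p /mapP[i _ ->].
by rewrite !muln1 => -[hG _]; exists G.
Qed.

(** With all [k^2] rungs, a [2 x k] ladder has [k^2 + 2 (k - 1)] edges, which
    reaches [N^2 / 4] for [k = N / 2] once [k >= 2]; a path handles the smaller
    values, among them [N = 3], where the ladder has a single edge. *)
Lemma exists_graph (R : realType) N m : (0 < N)%N -> (4 * m <= N ^ 2)%N ->
  exists G : grid_graph R 3, cr_admissible N m G.
Proof.
move=> N0 hm; have [N4|N4] := ltnP N 4.
  by apply: exists_path_graph => //; case: N N0 hm N4 => [|[|[|[|]]]] //; lia.
have hN := divn_eq N 2; have hr := ltn_pmod N (isT : (0 < 2)%N).
pose all_rungs := [seq (i, j) | i <- iota 1 (N %/ 2), j <- iota 1 (N %/ 2)].
have [||ij||G [hG _]] := @exists_ladder_graph R all_rungs (N %/ 2) m.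
- by lia.
- by rewrite allpairs_uniq ?iota_uniq // => -[? ?] [? ?].
- by case/allpairsP => -[i j] /= [+ + ->]; rewrite !mem_iota /=; lia.
- by rewrite size_allpairs size_iota; nia.
by exists G; apply: cr_admissible_leq hG; lia.
Qed.

(** * Crossing-free ladders *)

(** Taking the vector product of [c = t a - s b] with [b] expresses [t] as a
    quotient of integers with denominator [(vcross a b).2], which would make it
    an integer. *)
Lemma meets_at_unimodular (R : realType) a b c (t s : R) : 0 < t < 1 -> meets_at a b c t s ->
  absz (vcross a b).2 <> 1%N.
Proof.
move=> t01 [h1 h2 _] d1.
have e : (vcross c b).2%:~R = t * (vcross a b).2%:~R.
  by rewrite /vcross /= !(intrD, intrM, intrN) h1 h2; ring.
have : exists k : int, t = k%:~R.
  have [d|d] : (vcross a b).2 = 1 \/ (vcross a b).2 = -1 by lia.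
    by exists (vcross c b).2; rewrite e d mulr1.
  by exists (- (vcross c b).2); rewrite intrN e d mulrN1z mulrN1 opprK.
by case=> k tk; move: t01; rewrite tk => /int_open01.
Qed.

Definition zigzag (k : nat) : seq (nat * nat) :=
  [seq (i, i) | i <- iota 1 k] ++ [seq (i, i.+1) | i <- iota 1 k.-1].

(** The edge directions of the triangular lattice, with both signs. *)
Definition triangular_step (a : vec) : bool :=
  a \in [:: (1, 0, 0); (0, 1, 0); (1, 1, 0); (-1, 0, 0); (0, -1, 0); (-1, -1, 0)].

Lemma zigzag_step k p : p \in ladder (zigzag k) k ->
  triangular_step (diff p.1 p.2) /\ triangular_step (diff p.2 p.1).
Proof.
have S (i : nat) : i.+1%:Z - i%:Z = 1 by lia.
have S' (i : nat) : i%:Z - i.+1%:Z = -1 by lia.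
rewrite /ladder /rungs /zigzag map_cat !mem_cat -!map_comp.
by move=> /or3P[/orP[]||] /mapP[i _ ->]; rewrite /triangular_step /diff /= ?S ?S' !subrr.
Qed.

Lemma triangular_stepP a b : triangular_step a -> triangular_step b ->
  content a = 1%N /\ (vcross a b = (0, 0, 0) \/ absz (vcross a b).2 = 1%N).
Proof.
rewrite /triangular_step !inE => ha hb; split.
  by move: ha; do ![case/orP=> [/eqP ->|] //]; move/eqP => ->.
move: ha hb; do ?[case/orP=> [/eqP ->|] | move/eqP => ->];
  by [left|right].
Qed.

(** In the triangular lattice any two edge directions are parallel or span a
    unimodular parallelogram, and neither allows a crossing. *)
Lemma exists_planar_graph (R : realType) N m : (3 < N)%N -> (m + 3 <= 4 * (N %/ 2))%N ->
  exists G : grid_graph R 3, cr_admissible N m G /\ cr G = 0%N.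
Proof.
move=> N3 hm.
have hN := divn_eq N 2; have hr := ltn_pmod N (isT : (0 < 2)%N).
set k := (N %/ 2)%N in hm hN.
have [||ij||G [hG eG]] := @exists_ladder_graph R (zigzag k) k m.
- by lia.
- rewrite cat_uniq !map_inj_uniq ?iota_uniq; try by move=> i j [].
  rewrite andbT; apply/hasPn => p /mapP[i _ ->]; apply/negP => /mapP[j _ [<-]]; lia.
- by rewrite mem_cat => /orP[] /mapP[i + ->]; rewrite mem_iota /=; lia.
- by rewrite size_cat !size_map !size_iota; lia.
exists G; split; first by apply: cr_admissible_leq hG; lia.
apply: cr_eq0 => _ _ /eG[p /zigzag_step[p1 p2] ->] /eG[q /zigzag_step[q1 q2] ->].
move=> /edges_cross_meets_at[p' [q' [t [s [[<- pp] [<- qq] t01 s01 h]]]]].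
have sp : triangular_step (diff p'.1 p'.2) by case: pp => ->.
have sq : triangular_step (diff q'.1 q'.2) by case: qq => ->.
have [c1 [par|uni]] := triangular_stepP sp sq; last by case: (meets_at_unimodular t01 h uni).
have [c2 _] := triangular_stepP sq sp.
exact: crossing_parallel_eq t01 s01 h c1 c2 par.
Qed.

(** * Visibility graphs of cubes *)

(** [pickle] is used as an arbitrary injective numbering of the points, which
    selects one orientation of every pair. *)
Definition oriented_visible_pairs (n L : nat) : seq (npoint * npoint) :=
  [seq p <- visible_pairs n L | (choice.pickle p.1 < choice.pickle p.2)%N].

Lemma diff_rev u v : diff v u = scale (-1) (diff u v).
Proof. by rewrite /diff /scale /=; congr (_, _, _); ring. Qed.

Lemma visible_pairsP n L p : reflect
  [/\ p.1 \in cube n, p.2 \in cube n, content (diff p.1 p.2) = 1%N & (norm (diff p.1 p.2) <= L)%N]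
  (p \in visible_pairs n L).
Proof.
rewrite mem_filter; apply: (iffP andP).
  by move=> [/andP[/eqP h1 h2] /allpairsP[[u v] /= [hu hv ep]]]; move: h1 h2; rewrite ep.
by case: p => u v /= [h1 h2 -> ->]; rewrite eqxx allpairs_f.
Qed.

Lemma visible_pairs_uniq n L : uniq (visible_pairs n L).
Proof.
by rewrite filter_uniq // allpairs_uniq ?uniq_prod3 ?iota_uniq // => -[? ?] [? ?].
Qed.

Lemma size_oriented_visible_pairs n L :
  (size (visible_pairs n L) <= 2 * size (oriented_visible_pairs n L))%N.
Proof.
rewrite mul2n -addnn -[X in (_ + X)%N](size_map rev_pair) -size_cat.
apply: uniq_leq_size (visible_pairs_uniq n L) _ => -[u v] uv; rewrite mem_cat.
have [h1 h2 h3 h4] := visible_pairsP _ _ _ uv; rewrite /= in h1 h2 h3 h4.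
have [lt|lt|same] := ltngtP (choice.pickle u) (choice.pickle v).
- by rewrite mem_filter lt uv.
- apply/orP; right; apply/mapP; exists (v, u) => //; rewrite mem_filter lt.
  by apply/visible_pairsP; rewrite /= diff_rev content_scale norm_scale -[absz (-1)]/1%N !mul1n; split.
- by move: h3; rewrite (pcan_inj (@choice.pickleK _) same) /diff !subrr.
Qed.

Definition translate (u : npoint) (a : vec) : npoint :=
  (absz (u.1.1%:Z + a.1.1), absz (u.1.2%:Z + a.1.2), absz (u.2%:Z + a.2)).

Lemma translate_diff u v : translate u (diff u v) = v.
Proof. by case: v => [[x y] z]; rewrite /translate /=; congr (_, _, _); lia. Qed.

(** The pair of edges with starting points [u] and [u + c] and directions [a]
    and [b].  The coordinates of [translate] are only meaningful when the
    translated point is nonnegative, as it is for the edges of a graph. *)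
Definition decode (x : npoint * (vec * vec * vec)) : {fset {fset 'rV[nat]_3}} :=
  let: (u, (a, b, c)) := x in
  [fset edge_of (u, translate u a);
        edge_of (translate u c, translate (translate u c) b)].

(** Every crossing is decoded from the starting point of its first edge and a
    coplanar triple in the box of radius [2 L]. *)
Lemma exists_cube_graph (R : realType) n L m :
  (0 < n)%N -> (m <= size (oriented_visible_pairs n L))%N ->
  exists G : grid_graph R 3, cr_admissible (n * n * n) m G /\
    (cr G <= n ^ 3 * size (coplanar (2 * L)))%N.
Proof.
move=> n0 hm.
have [//|//|//|p||G [hG eG]] := @exists_visible_graph R n n n (oriented_visible_pairs n L) m.
- by rewrite mem_filter => /andP[_ /visible_pairsP[]].
- rewrite (@card_oriented_edges choice.pickle) ?(filter_uniq _ (visible_pairs_uniq _ _)) //.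
  by move=> p; rewrite mem_filter => /andP[].
exists G; split=> //.
pose s := [seq (u, t) | u <- cube n, t <- coplanar (2 * L)].
apply: (@leq_trans (size [seq decode x | x <- s])); last first.
  rewrite size_map size_allpairs size_prod3 size_iota leq_mul2r.
  by rewrite !expnS expn0 muln1 mulnA leqnn orbT.
apply: leq_trans (size_undup _); rewrite -card_fseq; apply: fsubset_leq_card.
apply/fsubsetP => c /crossingsP[_ [_ [/eG[p + ->] /eG[q + ->] /eqP ne -> X]]].
rewrite mem_filter => /andP[_ /visible_pairsP[p1 p2 pc pL]].
rewrite mem_filter => /andP[_ /visible_pairsP[q1 q2 qc qL]].
have [p' [q' [t [s' [[ep pp] [eq qq] t01 s01 h]]]]] := edges_cross_meets_at X.
have {p1 p2 pc pL pp} [p1 pc pL] : [/\ p'.1 \in cube n,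
    content (diff p'.1 p'.2) = 1%N & (norm (diff p'.1 p'.2) <= L)%N].
  by case: pp => ->;
    rewrite /= ?[diff p.2 _]diff_rev ?content_scale ?norm_scale -?[absz (-1)]/1%N ?mul1n; split.
have {q1 q2 qc qL qq} [qc qL] : content (diff q'.1 q'.2) = 1%N /\ (norm (diff q'.1 q'.2) <= L)%N.
  by case: qq => ->;
    rewrite /= ?[diff q.2 _]diff_rev ?content_scale ?norm_scale -?[absz (-1)]/1%N ?mul1n; split.
rewrite -ep -eq in ne *; rewrite !inE /=; apply/mapP.
exists (p'.1, (diff p'.1 p'.2, diff q'.1 q'.2, diff p'.1 q'.1)); last first.
  by rewrite /= !translate_diff; case: (p') (q') => [? ?] [? ?].
apply: allpairs_f => //; rewrite mem_filter mem_prod3 !mem_box /= pc (meets_at_norm t01 s01 h) //.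
rewrite (meets_at_coplanar h) eqxx !andbT /= (leq_trans pL) ?(leq_trans qL) ?leq_pmull //=.
by rewrite andbT; apply/eqP => par; apply: ne; apply: crossing_parallel_eq t01 s01 h pc qc par.
Qed.

(** * Choosing the cube and the range of visibility *)

Definition crossing_bound (R : realType) (N m : nat) : R :=
  m%:R ^+ 2 / N%:R * ln (m%:R / N%:R).

Lemma exists_cube_root N : exists n, (n ^ 3 <= N < n.+1 ^ 3)%N.
Proof.
have h n : (n ^ 3 <= N)%N -> (n <= N)%N.
  by apply: leq_trans; case: n => // n; rewrite -[X in (X <= _)%N]expn1 leq_pexp2l.
have [|n hn max] := @ex_maxnP (fun n => n ^ 3 <= N)%N N _ h; first by exists 0%N; rewrite exp0n.
by exists n; rewrite hn ltnNge; apply/negP => /max; rewrite ltnn.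
Qed.

Lemma full_visibility n : (40 <= n)%N ->
  (2 * n.+1 ^ 6 <= 8 * size (oriented_visible_pairs n n))%N.
Proof.
move=> hn; have := size_oriented_visible_pairs n n; have := @size_visible_pairs n n.
have -> : (1 < n <= n)%N by rewrite leqnn andbT; lia.
move=> /(_ isT) h1 h2.
suff : (2 * n.+1 ^ 6 + 20 * n ^ 3 * n ^ 2 <= 3 * n ^ 3 * n ^ 3)%N by lia.
have step k : (40 * n ^ k <= n ^ k.+1)%N by rewrite expnS leq_mul2r hn orbT.
have -> : (n.+1 ^ 6 =
    n ^ 6 + 6 * n ^ 5 + 15 * n ^ 4 + 20 * n ^ 3 + 15 * n ^ 2 + 6 * n ^ 1 + 1)%N by ring.
have -> : (3 * n ^ 3 * n ^ 3 = 3 * n ^ 6)%N by ring.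
have -> : (20 * n ^ 3 * n ^ 2 = 20 * n ^ 5)%N by ring.
have := step 5%N; have := step 4%N; have := step 3%N; have := step 2%N; have := step 1%N.
move: (n ^ 6)%N (n ^ 5)%N (n ^ 4)%N (n ^ 3)%N (n ^ 2)%N; rewrite expn1; lia.
Qed.

(** The least [L] that provides [m] pairs works: if it exceeds 20, then the
    range [L - 1] provides fewer than [m] pairs but, by [size_visible_pairs], at
    least [n^3 (L - 1)^3 / 4]; if not, [n^3 <= N <= m] is enough. *)
Lemma visibility_range n N m : (40 <= n)%N -> (n ^ 3 <= N < n.+1 ^ 3)%N ->
  (N <= m)%N -> (4 * m <= N ^ 2)%N ->
  exists L, [/\ (0 < L)%N, (m <= size (oriented_visible_pairs n L))%N &
    (n ^ 3 * L ^ 3 <= 20 ^ 3 * m)%N].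
Proof.
move=> n40 /andP[nN Nn] Nm mN.
pose P L := (0 < L)%N && (m <= size (oriented_visible_pairs n L))%N.
have Pn : P n.
  rewrite /P (leq_trans _ n40) //=.
  have := full_visibility n40.
  have : (N ^ 2 <= n.+1 ^ 6)%N by rewrite (_ : 6 = 3 * 2)%N // expnM leq_exp2r // ltnW.
  lia.
have [L /andP[L0 mL] Lmin] := @ex_minnP P (ex_intro (fun k => P k) n Pn).
exists L; split=> //.
have [L20|L20] := leqP L 20.
  by rewrite mulnC; apply: leq_mul; [rewrite leq_exp2r | apply: leq_trans Nm].
have LE : L = L.-1.+1 by rewrite prednK.
have lm : (size (oriented_visible_pairs n L.-1) < m)%N.
  rewrite ltnNge; apply/negP => h.
  have /Lmin : P L.-1 by rewrite /P h andbT; lia.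
  by lia.
have hl : (1 < L.-1 <= n)%N by have := Lmin _ Pn; lia.
have h1 := size_visible_pairs hl; have h2 := size_oriented_visible_pairs n L.-1.
move: LE L20 h1 h2 lm hl {mL Lmin}; move: (L.-1) => l -> L20 h1 h2 lm hl.
have h3 : (20 * n ^ 3 * l ^ 2 <= n ^ 3 * l ^ 3)%N.
  by rewrite [(20 * _)%N]mulnC -mulnA leq_mul2l [(l ^ 3)%N]expnS leq_mul2r; lia.
have h4 : (n ^ 3 * l.+1 ^ 3 <= 8 * (n ^ 3 * l ^ 3))%N.
  rewrite mulnCA leq_mul2l (_ : 8 = 2 ^ 3)%N // -expnMn leq_exp2r //; lia.
(* 32 = 8 * 4: the factor 8 is from [l + 1 <= 2 l], the 4 from the pair count. *)
apply: (@leq_trans (32 * m)%N); last by rewrite leq_mul2r orbC.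
move: h1 h2 h3 h4 lm; rewrite -!mulnA.
move: (n ^ 3 * l ^ 3)%N (n ^ 3 * l ^ 2)%N (n ^ 3 * l.+1 ^ 3)%N (size _) (size _).
lia.
Qed.

(** Write [q = m / N >= 3/2].  Then [L^3 = O(q)], so the harmonic factor
    [1 + ln (8 L^2)] is at most [ln q] plus a constant, and the constant is
    absorbed since [ln q >= 1/3]. *)
Lemma exists_dense_graph (R : realType) : exists2 C : R, 0 <= C & forall n N m,
  (40 <= n)%N -> (n ^ 3 <= N < n.+1 ^ 3)%N -> (3 * N <= 2 * m)%N -> (4 * m <= N ^ 2)%N ->
  exists G : grid_graph R 3, cr_admissible N m G /\ (cr G)%:R <= C * crossing_bound R N m.
Proof.
pose A : R := ln (16 * 20 ^+ 3).
have A0 : 0 <= A by apply: ln_ge0; rewrite -natrX -natrM ler1n muln_gt0 expn_gt0.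
pose D : R := 26 * 18 ^+ 3 * 2 ^+ 6.
have D0 : 0 <= D by rewrite !mulr_ge0 ?exprn_ge0.
pose K : R := 20 ^+ 3; have K0 : 0 < K by rewrite exprn_gt0.
exists (D * (2 * K ^+ 2) * (3 * (1 + A) + 1)).
  by rewrite !mulr_ge0 ?exprn_ge0 ?addr_ge0 ?mulr_ge0 ?addr_ge0 // ltW.
move=> n N m n40 nN Nm mN.
have Nm' : (N <= m)%N by lia.
have [L [L0 mL hL]] := visibility_range n40 nN Nm' mN.
have n0 : (0 < n)%N by lia.
have [G [hG crG]] := exists_cube_graph R n0 mL.
case/andP: nN => nN Nn.
exists G; split; first by apply: cr_admissible_leq hG; rewrite -mulnA.
have N0 : (0 < N)%N by apply: leq_trans nN; rewrite expn_gt0 n0.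
have N2n : (N <= 2 * n ^ 3)%N.
  apply: (leq_trans (ltnW Nn)).
  have step k : (40 * n ^ k <= n ^ k.+1)%N by rewrite expnS leq_mul2r n40 orbT.
  have := step 0%N; have := step 1%N; have := step 2%N.
  have -> : (n.+1 ^ 3 = n ^ 3 + 3 * n ^ 2 + 3 * n ^ 1 + 1)%N by ring.
  by rewrite expn0; lia.
pose x : R := n%:R ^+ 3; pose l : R := L%:R; pose M : R := m%:R; pose V : R := N%:R.
have x0 : 0 < x by rewrite exprn_gt0 ?ltr0n.
have l1 : 1 <= l by rewrite ler1n.
have m0 : (0 < m)%N by apply: leq_trans Nm'.
have M0 : 0 < M by rewrite ltr0n.
have V0 : 0 < V by rewrite ltr0n.
have xl : x * l ^+ 3 <= K * M by rewrite /K /x /l /M -!natrX -!natrM ler_nat.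
have Vx : V <= 2 * x by rewrite /V /x -!natrX -!natrM ler_nat.
pose q := M / V.
have q32 : 3 / 2 <= q.
  rewrite /q ler_pdivlMr // mulrAC ler_pdivrMr // /M /V -!natrM ler_nat; lia.
have q0 : 0 < q by rewrite divr_gt0.
have l3 : l ^+ 3 <= 2 * K * q.
  rewrite /q mulrA ler_pdivlMr //.
  apply: (@le_trans _ _ (l ^+ 3 * (2 * x))); first by rewrite ler_wpM2l ?exprn_ge0 //; lra.
  rewrite (_ : l ^+ 3 * _ = 2 * (x * l ^+ 3)); last by ring.
  by rewrite -mulrA ler_pM2l.
have lnq : 1 / 3 <= ln q.
  apply: le_trans (ln_ge_1V q0).
  have : q^-1 <= (3 / 2)^-1 by rewrite lef_pV2 ?posrE ?divr_gt0.
  lra.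
have lnL : ln (2 * (2 * L)%:R ^+ 2) <= A + ln q :> R.
  rewrite /A -lnM ?posrE ?mulr_gt0 ?exprn_gt0 ?invr_gt0 //.
  rewrite ler_ln ?posrE ?mulr_gt0 ?exprn_gt0 ?invr_gt0 ?ltr0n ?muln_gt0 //.
  rewrite natrM -/l.
  have h : 8 * l ^+ 2 <= 8 * l ^+ 3 by rewrite ler_pM2l // ler_weXn2l.
  have h2 : 16 * K * q = 8 * (2 * K * q) by ring.
  rewrite -/K h2; apply: le_trans (_ : 8 * l ^+ 3 <= _); last by rewrite ler_pM2l.
  by apply: le_trans h; rewrite le_eqVlt; apply/orP; left; apply/eqP; ring.
apply: (@le_trans _ _ ((n ^ 3 * size (coplanar (2 * L)))%N%:R : R)); first by rewrite ler_nat.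
rewrite natrM natrX -/x.
apply: (@le_trans _ _ (x * (D * l ^+ 6 * ((3 * (1 + A) + 1) * ln q)))).
  rewrite ler_pM2l //; have L20 : (0 < 2 * L)%N by rewrite muln_gt0.
  apply: le_trans (size_coplanar_le_ln R L20) _.
  rewrite (_ : 26 * _ * (2 * L)%:R ^+ 6 = D * l ^+ 6); last by rewrite natrM /D -/l; ring.
  rewrite ler_wpM2l ?mulr_ge0 ?exprn_ge0 //.
  have : (1 + A) * 1 <= (1 + A) * (3 * ln q) by rewrite ler_wpM2l //; lra.
  lra.
have xl6 : x * l ^+ 6 <= 2 * K ^+ 2 * (M ^+ 2 / V).
  rewrite mulrA ler_pdivlMr // -(ler_pM2l x0).
  apply: (@le_trans _ _ (x * (x * l ^+ 6) * (2 * x))).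
    rewrite (_ : x * (_ * V) = x * (x * l ^+ 6) * V); last by ring.
    by rewrite ler_wpM2l // !mulr_ge0 ?exprn_ge0 // ltW.
  rewrite (_ : _ * (2 * x) = 2 * x * (x * l ^+ 3) ^+ 2); last by ring.
  rewrite [X in _ <= X](_ : _ = 2 * x * (K * M) ^+ 2); last by ring.
  rewrite ler_pM2l; last by lra.
  by apply: lerXn2r xl; rewrite nnegrE ltW ?mulr_gt0 ?exprn_gt0 ?ltr0n.
rewrite /crossing_bound -/M -/V -/q.
rewrite [X in X <= _](_ : _ = D * (3 * (1 + A) + 1) * ln q * (x * l ^+ 6)); last by ring.
rewrite [X in _ <= X](_ : _ = D * (3 * (1 + A) + 1) * ln q * (2 * K ^+ 2 * (M ^+ 2 / V))); last by ring.
rewrite ler_wpM2l // !mulr_ge0 //; lra.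
Qed.

(** * The crossing number bound *)

Lemma crossing_number_planar (R : realType) N m (x : R) : (3 < N)%N -> (m + 3 <= 4 * (N %/ 2))%N ->
  0 <= x -> exists k, is_cr_min R 3 N m k /\ k%:R <= x.
Proof.
move=> N3 hm x0; have [G [hG crG]] := exists_planar_graph R N3 hm.
have [k [hk kG]] := is_cr_min_le hG; exists k; split=> //.
by move: kG; rewrite crG leqn0 => /eqP ->.
Qed.

(** The bound vanishes only for [m = 0] and [m = N].  A graph without edges has
    no crossing, and [m = N] forces [N >= 4], where a crossing-free ladder
    exists. *)
Lemma crossing_number_pointwise (R : realType) N m : (0 < N)%N -> (4 * m <= N ^ 2)%N ->
  exists C : R, exists k, is_cr_min R 3 N m k /\ k%:R <= C * `|crossing_bound R N m|.
Proof.
move=> N0 hm; have [G hG] := exists_graph R N0 hm.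
have [mN|mN] := eqVneq m N.
  exists 0; apply: crossing_number_planar; rewrite ?mul0r //; first by nia.
  by have := divn_eq N 2; have := ltn_pmod N (isT : (0 < 2)%N); nia.
(* Now the bound is zero only if [m = 0]; otherwise it is inverted. *)
have [k [hk kG]] := is_cr_min_le hG.
have [m0|m0] := posnP m.
  exists 0, k; split=> //; move: kG; rewrite cr_eq0 ?mul0r; first by rewrite leqn0 => /eqP ->.
  by move: hG.1; rewrite m0 => /cardfs0_eq -> e f; rewrite in_fset0.
exists (k%:R / `|crossing_bound R N m|), k; split=> //.
rewrite divfK // normr_eq0 mulf_neq0 //.
  by rewrite mulf_neq0 ?expf_neq0 ?invr_eq0 ?pnatr_eq0 -?lt0n.
rewrite ln_eq0 ?divr_gt0 ?ltr0n //.
by rewrite (can2_eq (divfK _) (mulfK _)) ?mul1r ?eqr_nat // pnatr_eq0 -lt0n.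
Qed.

Lemma crossing_number_bounded (R : realType) (N1 : nat) : exists2 C : R, 0 <= C & forall N m,
  (0 < N)%N -> (4 * m <= N ^ 2)%N -> (N < N1)%N ->
  exists k, is_cr_min R 3 N m k /\ k%:R <= C * `|crossing_bound R N m|.
Proof.
have /boolp.choice[C hC] : forall p : nat * nat, exists C : R,
    (0 < p.1)%N -> (4 * p.2 <= p.1 ^ 2)%N ->
    exists k, is_cr_min R 3 p.1 p.2 k /\ k%:R <= C * `|crossing_bound R p.1 p.2|.
  move=> [N m] /=; have [N0|] := boolP (0 < N)%N; last by exists 0.
  have [hm|] := boolP (4 * m <= N ^ 2)%N; last by exists 0.
  by have [C hC] := crossing_number_pointwise R N0 hm; exists C.
exists (\sum_(i < N1) \sum_(j < N1 ^ 2) `|C (i : nat, j : nat)|).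
  by rewrite !sumr_ge0 // => i _; rewrite sumr_ge0.
move=> N m N0 hm NN; have [k [hk kC]] := hC (N, m) N0 hm; exists k; split=> //.
apply: le_trans kC _; rewrite ler_wpM2r //=.
have mN : (m < N1 ^ 2)%N.
  have : (N ^ 2 < N1 ^ 2)%N by rewrite ltn_exp2r.
  lia.
rewrite (bigD1 (Ordinal NN)) //= (bigD1 (Ordinal mN)) //= -addrA.
apply: le_trans (ler_norm _) _; rewrite lerDl addr_ge0 ?sumr_ge0 // => i _; rewrite sumr_ge0 //.
Qed.

Theorem theorem2 (R : realType) :
  exists C : R, forall N m : nat,
    (0 < N)%N -> m%:R <= N%:R ^+ 2 / 4 :> R ->
    exists k : nat, is_cr_min R 3 N m k /\
      k%:R <= C * `|m%:R ^+ 2 / N%:R * ln (m%:R / N%:R)|.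
Proof.
have [C1 C10 large] := exists_dense_graph R.
have [C2 C20 small] := crossing_number_bounded R (40 ^ 3).
exists (C1 + C2) => N m N0; rewrite ler_pdivlMr ?ltr0n // -natrX -natrM ler_nat mulnC => hm.
rewrite -/(crossing_bound R N m).
have [NN|NN] := ltnP N (40 ^ 3).
  have [k [hk kC]] := small N m N0 hm NN; exists k; split=> //.
  by apply: le_trans kC _; rewrite ler_wpM2r // lerDr.
have [n /andP[nN Nn]] := exists_cube_root N.
have n40 : (40 <= n)%N by rewrite -ltnS -(@ltn_exp2r _ _ 3) //; apply: leq_ltn_trans NN Nn.
have [mN|mN] := ltnP (2 * m) (3 * N).
  have N40 : (40 <= N)%N.
    by apply: leq_trans n40 (leq_trans _ nN); rewrite -[X in (X <= _)%N]expn1 leq_pexp2l //; lia.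
  apply: crossing_number_planar; first by lia.
    by have := divn_eq N 2; have := ltn_pmod N (isT : (0 < 2)%N); lia.
  by rewrite mulr_ge0 ?addr_ge0.
have [|G [hG crG]] := large n N m n40 _ mN hm; first by rewrite nN Nn.
have [k [hk kG]] := is_cr_min_le hG; exists k; split=> //.
apply: (@le_trans _ _ (C1 * crossing_bound R N m)).
  by apply: le_trans crG; rewrite ler_nat.
apply: (@le_trans _ _ (C1 * `|crossing_bound R N m|)); first by rewrite ler_wpM2l ?ler_norm.
by rewrite ler_wpM2r // lerDl.
Qed.
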